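(* Let $w_n$ be the number of weak-ordering chains in $\mathcal{WOC}(n)$ subject to the stopping condition $x_i\le x_j$ with $i<j$ (i.e. a chain contains the stopping condition if there are indices $i<j$ with $x_i<x_j$ or $x_i=x_j$ in the chain). Then $w_n=n^2-n+1$ for all $n\ge 1$. The sequence starts $1,3,7,13,21,31,43,57,\dots$.
   Context: A weak-ordering chain on $x_1,\dots,x_m$ is an expression $x_{i_1}\,\mathrm{op}\,x_{i_2}\,\mathrm{op}\cdots\mathrm{op}\,x_{i_m}$, where $(i_1,\dots,i_m)$ is an ordering of $[m]=\{1,\dots,m\}$ and each $\mathrm{op}$ is $<$ or $=$; two expressions defining the same ordered set partition of $[m]$ (blocks = index sets of equal variables, ordered by increasing value) are identified. $\mathcal{WOC}(m)$ is the set of these chains. Each chain in $\mathcal{WOC}(m)$, $m\ge 2$, arises uniquely from its restriction to $x_1,\dots,x_{m-1}$ (a chain in $\mathcal{WOC}(m-1)$) by inserting $x_m$; this gives a rooted tree with root $x_1$ whose level-$m$ nodes are the elements of $\mathcal{WOC}(m)$. Given a stopping condition, the restricted generating tree of order $n$ is the part of this tree up to level $n$ in which any node whose chain contains the stopping condition has no descendants. Its leaves are the nodes at level $n$ together with the nodes containing the stopping condition. ''The number of weak-ordering chains in $\mathcal{WOC}(n)$ subject to the stopping condition'' means the number of leaves of this restricted tree of order $n$; equivalently, the number of chains in $\mathcal{WOC}(n)$ not containing the condition plus, for each $1\le j\le n$, the number of chains in $\mathcal{WOC}(j)$ that contain the condition while their restriction to $x_1,\dots,x_{j-1}$ does not.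 *)

(* Defs.v *)
From HB Require Import structures.
From mathcomp Require Import all_boot.

Set Implicit Arguments.
Unset Strict Implicit.
Unset Printing Implicit Defensive.

(* Variables are indexed from 0: the ordinal i : 'I_m stands for x_(i+1). *)

Definition is_osp (T : finType) (s : seq {set T}) : bool :=
  uniq s && partition [set B in s] [set: T].

(* WOC(m).  A chain is its ordered set partition: the blocks are the index sets
   of equal variables, listed by increasing value.  The bound on the number of
   blocks excludes nothing (osp_size); it only makes the type finite. *)
Record woc (m : nat) : predArgType :=
  Woc { blocks :> m.-bseq {set 'I_m}; blocksP : is_osp blocks }.

HB.instance Definition _ m := [isSub for @blocks m].
HB.instance Definition _ m := [Finite of woc m by <:].

Lemma osp_size (m : nat) (s : seq {set 'I_m}) : is_osp s -> size s <= m.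
Proof.
case/andP=> us ps; rewrite -[X in _ <= X]card_ord -cardsT (card_partition ps).
rewrite -(card_uniqP us) -cardsE -sum1_card leq_sum // => B BP.
by rewrite card_gt0 (partition_neq0 ps BP).
Qed.

Definition restrict_blocks (m : nat) (s : seq {set 'I_m.+1}) : seq {set 'I_m} :=
  [seq B <- [seq widen_ord (leqnSn m) @^-1: B | B : {set 'I_m.+1} <- s] | B != set0].

Lemma restrict_osp (m : nat) (s : seq {set 'I_m.+1}) :
  is_osp s -> is_osp (restrict_blocks s).
Proof.
case/andP=> us ps; set w := widen_ord (leqnSn m).
have eqB A B i : A \in s -> B \in s -> i \in A -> i \in B -> A = B.
  move=> As Bs iA iB; apply/eqP; apply: contraT => nAB.
  have /trivIsetP/(_ A B) := partition_trivIset ps.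
  rewrite !inE => /(_ As Bs nAB) /pred0P/(_ i) /=.
  by rewrite iA iB.
apply/andP; split.
  rewrite /restrict_blocks filter_map map_inj_in_uniq ?filter_uniq // => A B.
  rewrite !mem_filter => /andP[/= /set0Pn[i iA] As] /andP[_ Bs] eAB.
  have := iA; rewrite eAB; move: iA; rewrite !inE => iA iB.
  exact: eqB As Bs iA iB.
apply/and3P; split.
- apply/eqP/setP=> i; rewrite inE.
  have: w i \in cover [set B in s] by rewrite (cover_partition ps) inE.
  case/bigcupP=> B; rewrite inE => Bs iB; apply/bigcupP.
  exists (w @^-1: B); last by rewrite inE.
  rewrite inE mem_filter map_f // andbT.
  by apply/set0Pn; exists i; rewrite inE.
- apply/trivIsetP=> A' B'; rewrite !inE !mem_filter.
  case/andP=> _ /mapP[A As ->] /andP[_ /mapP[B Bs ->]] nAB.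
  apply/pred0P=> i /=; rewrite !inE; apply/negP=> /andP[iA iB].
  by case/eqP: nAB; rewrite (eqB A B _ As Bs iA iB).
- by rewrite inE mem_filter eqxx.
Qed.

(* The restriction of a chain on x_1, ..., x_(m+1) to x_1, ..., x_m, i.e. the
   parent of a node in the generating tree. *)
Definition restrict (m : nat) (c : woc m.+1) : woc m :=
  let cP := restrict_osp (blocksP c) in @Woc m (Bseq (osp_size cP)) cP.

(* The position, in the chain c, of the block containing i. *)
Definition block_index (m : nat) (c : woc m) (i : 'I_m) : nat :=
  find (fun B : {set 'I_m} => i \in B) c.

Definition var_lt (m : nat) (c : woc m) (i j : 'I_m) : bool :=
  block_index c i < block_index c j.

Definition var_eq (m : nat) (c : woc m) (i j : 'I_m) : bool :=
  block_index c i == block_index c j.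

(* [stop m c] says that the chain c in WOC(m) contains the condition. *)
Definition stopping_condition : Type := forall m : nat, pred (woc m).

(* The level-m nodes of the restricted generating tree: level 1 consists of the
   root, and a node has children only if it does not contain the condition. *)
Fixpoint tree_level (stop : stopping_condition) (m : nat) : {set woc m} :=
  match m return {set woc m} with
  | 0 => set0
  | k.+1 => [set c : woc k.+1 | (k == 0) ||
      (restrict c \in tree_level stop k) && ~~ stop k (restrict c)]
  end.

Definition leaves (stop : stopping_condition) (n j : nat) : {set woc j} :=
  [set c in tree_level stop j | (j == n) || stop j c].

(* The number of weak-ordering chains in WOC(n) subject to [stop]. *)
Definition num_chains (stop : stopping_condition) (n : nat) : nat :=
  \sum_(1 <= j < n.+1) #|leaves stop n j|.

Definition stop_le : stopping_condition := fun m c =>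
  [exists i : 'I_m, exists j : 'I_m,
     (i < j) && (var_lt c i j || var_eq c i j)].

(* Main.v *)
(* A chain free of the condition on x_1, ..., x_k must be x_k < ... < x_1, which
   has k blocks and hence 2k + 1 children: k + 1 insertions of a new block and k
   insertions into an existing block.  Only the insertion of x_(k+1) as a new
   least block avoids the condition, so 2k children are leaves.  Thus
   w_n = 1 + \sum_(k < n) 2k = n(n - 1) + 1. *)
Require Import Defs.
From mathcomp Require Import all_boot.

Set Implicit Arguments.
Unset Strict Implicit.
Unset Printing Implicit Defensive.

(** * Ordered set partitions by counting blocks *)

(** One count per element replaces distinctness, covering and disjointness, a form suited to
    induction on the list of blocks. *)
Lemma is_ospE (T : finType) (s : seq {set T}) :
  is_osp s =
  (set0 \notin s) && [forall i, count (fun B : {set T} => i \in B) s == 1].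
Proof.
apply/idP/idP=> [/andP[us /and3P[/eqP cs ts s0]] | /andP[s0 /forallP cs]].
  move: s0; rewrite inE => -> /=; apply/forallP=> i.
  have: i \in cover [set B in s] by rewrite cs inE.
  case/bigcupP=> B; rewrite inE => Bs iB.
  have cB : count_mem B s = 1 by rewrite count_uniq_mem ?Bs.
  rewrite -cB; apply/eqP; apply: eq_in_count => A As /=; apply/idP/eqP=> [iA|-> //].
  apply/eqP; apply: contraT => nAB.
  have /trivIsetP/(_ A B) := ts.
  by rewrite !inE => /(_ As Bs nAB) /pred0P/(_ i) /=; rewrite iA iB.
(* [A] already uses up the count 1 of [i], so once one occurrence of it is deleted no block contains
   [i]. With [B = A] this gives distinctness, otherwise disjointness. *)
have disj (A B : {set T}) i :
    A \in s -> i \in A -> i \in B -> B \in rem A s -> False.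
  move=> As iA iB Bs; have := cs i.
  rewrite (permP (perm_to_rem As)) /= iA add1n eqSS -leqn0 leqNgt -has_count.
  by case/hasP; exists B.
apply/andP; split.
  apply: count_mem_uniq => A; have [As|As] := boolP (A \in s); last first.
    exact/count_memPn.
  rewrite (permP (perm_to_rem As)) /= eqxx; apply/eqP; rewrite eqSS.
  apply/eqP/count_memPn/negP=> As'.
  have /set0Pn[i iA]: A != set0 by apply: contraNneq s0 => <-.
  exact: (disj A A i).
apply/and3P; split; last by rewrite inE.
  apply/eqP/setP=> i; rewrite inE; apply/bigcupP.
  have /hasP[B Bs iB]: has (fun B : {set T} => i \in B) s.
    by rewrite has_count (eqP (cs i)).
  by exists B; rewrite ?inE.
apply/trivIsetP=> A B; rewrite !inE => As Bs nAB.
apply/pred0P=> i /=; apply/negP=> /andP[iA iB].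
apply: (disj A B i) => //; have := Bs.
by rewrite (perm_mem (perm_to_rem As)) inE eq_sym (negbTE nAB).
Qed.

(** * Inserting the last variable into a list of blocks *)

Section Insertion.

Variable k : nat.
Implicit Types (i : 'I_k) (B : {set 'I_k}) (s : seq {set 'I_k}) (d : woc k).

Local Notation w := (widen_ord (leqnSn k)).

Lemma widen_ord_inj : injective w.
Proof. by move=> i j /(congr1 val) /= ij; apply: val_inj. Qed.

Variant ord_last_spec : 'I_k.+1 -> Type :=
  | OrdLastMax : ord_last_spec ord_max
  | OrdLastWiden i : ord_last_spec (w i).

Lemma ord_lastP (i : 'I_k.+1) : ord_last_spec i.
Proof.
case: (unliftP ord_max i) => [j ->|->]; last by left.
rewrite (_ : lift _ _ = w j); first by right.
by apply: val_inj; rewrite /= /bump leqNgt ltn_ord.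
Qed.

Lemma widen_neq_max i : (w i == ord_max) = false.
Proof. by rewrite -val_eqE /= ltn_eqF. Qed.

Definition widen_set B : {set 'I_k.+1} := w @: B.

Lemma mem_widen_set i B : (w i \in widen_set B) = (i \in B).
Proof. by rewrite mem_imset //; apply: widen_ord_inj. Qed.

Lemma max_widen_set B : (ord_max \in widen_set B) = false.
Proof.
by apply/imsetP => -[i _ /esym/eqP]; rewrite widen_neq_max.
Qed.

Lemma widen_setK : cancel widen_set (fun B : {set _} => w @^-1: B).
Proof. by move=> B; apply/setP=> i; rewrite inE mem_widen_set. Qed.

Lemma preim_widenK (B : {set 'I_k.+1}) :
  ord_max \notin B -> widen_set (w @^-1: B) = B.
Proof.
move=> mB; apply/setP=> i; case: (ord_lastP i) => [|j].
  by rewrite max_widen_set (negbTE mB).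
by rewrite mem_widen_set inE.
Qed.

Lemma preim_widenU1 B : w @^-1: (ord_max |: widen_set B) = B.
Proof. by apply/setP=> i; rewrite !inE widen_neq_max mem_widen_set. Qed.

Lemma setU1_preim_widen (B : {set 'I_k.+1}) :
  ord_max \in B -> ord_max |: widen_set (w @^-1: B) = B.
Proof.
move=> mB; apply/setP=> i; rewrite in_setU1; case: (ord_lastP i) => [|j].
  by rewrite eqxx mB.
by rewrite widen_neq_max mem_widen_set inE.
Qed.

(* The chains over s are the [insert s p] with p <= 2 * size s: the last variable
   forms a new block in front of block p./2 if p is even, joins that block if p
   is odd. *)
Fixpoint insert s (p : nat) : seq {set 'I_k.+1} :=
  match s, p with
  | B :: s', 1 => (ord_max |: widen_set B) :: map widen_set s'
  | B :: s', p'.+2 => widen_set B :: insert s' p'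
  | _, _ => [set ord_max] :: map widen_set s
  end.

Lemma insert0 s : insert s 0 = [set ord_max] :: map widen_set s.
Proof. by case: s. Qed.

Lemma widen_set_eq0 B : (widen_set B == set0) = (B == set0).
Proof. by rewrite imset_eq0. Qed.

Lemma set0_map_widen s : (set0 \in map widen_set s) = (set0 \in s).
Proof.
by elim: s => //= B s IH; rewrite !inE IH ![set0 == _]eq_sym widen_set_eq0.
Qed.

Lemma count_map_widen i s :
  count (fun B : {set _} => w i \in B) (map widen_set s) =
  count (fun B : {set _} => i \in B) s.
Proof. by rewrite count_map; apply: eq_count => B /=; rewrite mem_widen_set. Qed.

Lemma count_max_map_widen s :
  count (fun B : {set _} => ord_max \in B) (map widen_set s) = 0.
Proof.
rewrite count_map -(count_pred0 s).
by apply: eq_count => B /=; rewrite max_widen_set.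
Qed.

Lemma insert_osp s p : is_osp s -> is_osp (insert s p).
Proof.
rewrite !is_ospE => /andP[s0 /forallP cs].
have max1_neq0 : (set0 == [set ord_max : 'I_k.+1]) = false.
  by rewrite eq_sym; apply/set0Pn; exists ord_max; rewrite inE.
have maxU_neq0 B : (set0 == ord_max |: widen_set B) = false.
  by rewrite eq_sym; apply/set0Pn; exists ord_max; rewrite !inE eqxx.
apply/andP; split.
  elim: s p s0 {cs} => [|B s IH] [|[|p]]; rewrite /= ?(inE, max1_neq0) //=.
  - by rewrite set0_map_widen ![set0 == _]eq_sym widen_set_eq0.
  - by rewrite maxU_neq0 set0_map_widen => /norP[].
  - rewrite ![set0 == _]eq_sym widen_set_eq0 => /norP[/negbTE-> s0]; exact: IH.
apply/forallP=> i; case: (ord_lastP i) => [|{}i].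
  elim: s p {s0 cs} => [|B s IH] [|[|p]] //=;
    rewrite ?max_widen_set ?(in_setU1, in_set1, eqxx) /= ?max_widen_set;
    by rewrite ?count_max_map_widen ?add0n ?IH.
rewrite -(eqP (cs i)); apply/eqP; elim: s p {s0 cs} => [|B s IH] [|[|p]] //=;
  by rewrite ?IH ?(in_setU1, in_set1) ?widen_neq_max ?mem_widen_set
             ?count_map_widen.
Qed.

Lemma restrict_map_widen s :
  set0 \notin s -> restrict_blocks (map widen_set s) = s.
Proof.
elim: s => //= B s IH; rewrite inE eq_sym => /norP[B0 /IH es].
by rewrite /restrict_blocks /= widen_setK B0 -[in RHS]es.
Qed.

Lemma preim_set1_max : w @^-1: [set ord_max] = set0.
Proof. by apply/setP=> i; rewrite !inE widen_neq_max. Qed.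

(** Preimages under widening erase the last variable; if it formed a block of its own, that block
    becomes empty and is filtered out. An empty block of [s] would be lost in the same way. *)
Lemma restrict_insert s p : set0 \notin s -> restrict_blocks (insert s p) = s.
Proof.
elim: s p => [|B s IH] p.
  by rewrite /restrict_blocks; case: p => [|p] _ /=; rewrite preim_set1_max eqxx.
rewrite inE eq_sym => /norP[B0 s0].
have es := restrict_map_widen s0; have {IH} := IH _ s0.
rewrite /restrict_blocks /= in es *.
case: p => [|[|p]] IH /=.
- by rewrite preim_set1_max eqxx /= widen_setK B0 es.
- by rewrite preim_widenU1 B0 es.
- by rewrite widen_setK B0 IH.
Qed.

(** The first block of the result separates the cases 0, 1 and at least 2: it is the singleton of
    the last variable, contains it properly, or avoids it. Beyond the bound, [insert s] is
    constant. *)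
Lemma insert_inj s p q : set0 \notin s -> p <= (size s).*2 -> q <= (size s).*2 ->
  insert s p = insert s q -> p = q.
Proof.
have max_neq B : [set ord_max] <> widen_set B.
  by move/setP/(_ ord_max); rewrite inE eqxx max_widen_set.
have maxU_neq B B' : ord_max |: widen_set B <> widen_set B'.
  by move/setP/(_ ord_max); rewrite in_setU1 eqxx /= max_widen_set.
have max_neqU B : B != set0 -> [set ord_max] <> ord_max |: widen_set B.
  case/set0Pn=> i iB /setP/(_ (w i)).
  by rewrite in_setU1 in_set1 widen_neq_max mem_widen_set iB.
elim: s p q => [|B s IH] p q; first by case: p; case: q.
rewrite inE eq_sym => /norP[B0 s0].
case: p q => [|[|p]] [|[|q]] //= lep leq [].
- by move/max_neqU.
- by move/max_neq.
- by move/esym/max_neqU.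
- by move/maxU_neq.
- by move/esym/max_neq.
- by move/esym/maxU_neq.
- by move/(IH _ _ s0 lep leq) => ->.
Qed.

Lemma insert_surj (t : seq {set 'I_k.+1}) :
  set0 \notin t -> count (fun B : {set _} => ord_max \in B) t = 1 ->
  exists2 p, p <= (size (restrict_blocks t)).*2 &
             t = insert (restrict_blocks t) p.
Proof.
elim: t => //= B t IH; rewrite inE eq_sym => /norP[B0 t0].
have [mB [/eqP ct]|mB /(IH t0) [p lep et]] := boolP (ord_max \in B).
  (* [B] takes the whole count, so no block of [t] contains the last variable. *)
  have et : map widen_set (restrict_blocks t) = t.
    move: ct; rewrite eqn0Ngt -has_count => /hasPn mt.
    elim: t t0 mt {IH} => //= A t IH; rewrite inE eq_sym => /norP[A0 t0] mt.
    have eA := preim_widenK (mt A (mem_head _ _)).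
    have {}IH := IH t0 (fun C Ct => mt C (mem_behead (s := A :: t) Ct)).
    by rewrite /restrict_blocks /= -widen_set_eq0 eA A0 /= eA -[in RHS]IH.
  have eB := setU1_preim_widen mB; move: et; rewrite /restrict_blocks /=.
  (* An empty preimage means that [B] is a new singleton block; otherwise the last variable joined
     an old block. *)
  have [pB0|pB0 /=] := eqVneq (w @^-1: B) set0 => /= et.
    by exists 0; rewrite ?insert0 ?et // -eB pB0 /widen_set imset0 setU0.
  by exists 1; rewrite //= eB et.
have eB := preim_widenK mB.
move: lep et; rewrite /restrict_blocks /= -widen_set_eq0 eB B0 /= => lep et.
by exists p.+2; rewrite /= ?ltnS // eB -et.
Qed.

Lemma woc_inj : injective (fun d => blocks d : seq {set 'I_k}).
Proof. by move=> c d /val_inj/val_inj. Qed.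

Definition child d (p : nat) : woc k.+1 :=
  let cP := insert_osp p (blocksP d) in @Woc k.+1 (Bseq (osp_size cP)) cP.

Lemma woc_neq0 d : set0 \notin (d : seq _).
Proof. by have := blocksP d; rewrite is_ospE => /andP[]. Qed.

End Insertion.

(** * Children of a node and the stopping condition *)

Lemma restrict_child k (d : woc k) p : restrict (child d p) = d.
Proof. by apply: woc_inj; apply: restrict_insert; apply: woc_neq0. Qed.

Lemma restrict_fiber k (d : woc k) :
  [set c | restrict c == d] = [set child d (val p) | p : 'I_(size d).*2.+1].
Proof.
apply/setP=> c; rewrite inE; apply/eqP/imsetP=> [<-|[p _ ->]]; last first.
  exact: restrict_child.
have := blocksP c; rewrite is_ospE => /andP[c0 /forallP/(_ ord_max)/eqP c1].
have [p lep ec] := insert_surj c0 c1.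
by exists (Ordinal (lep : p < _.+1)) => //; apply: woc_inj.
Qed.

Lemma card_restrict_fiber k (d : woc k) :
  #|[set c | restrict c == d]| = (size d).*2.+1.
Proof.
rewrite restrict_fiber card_imset ?card_ord // => p q.
move/(congr1 (fun c => blocks c : seq _)).
by move/(insert_inj (woc_neq0 d) (ltn_ord p) (ltn_ord q))/val_inj.
Qed.

Lemma stop_leE m (c : woc m) :
  stop_le c =
  [exists i : 'I_m, exists j : 'I_m,
     (i < j) && (block_index c i <= block_index c j)].
Proof.
by apply: eq_existsb => i; apply: eq_existsb => j; rewrite orbC -leq_eqVlt.
Qed.

(** For [p = 0] the last variable becomes the strict minimum and the old order is kept. For [p > 0]
    the variables of the first old block remain in first position, hence are weakly below the last
    variable. *)
Lemma stop_child k (d : woc k) p :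
  ~~ stop_le d -> p <= (size d).*2 -> stop_le (child d p) = (p != 0).
Proof.
rewrite !stop_leE => nd lep; case: p => [|p] in lep *.
  apply/negbTE; apply: contra nd => /existsP[i /existsP[j]].
  have ind (l : 'I_k) :
      block_index (child d 0) (widen_ord (leqnSn k) l) = (block_index d l).+1.
    rewrite /block_index /= insert0 /= inE widen_neq_max find_map; congr _.+1.
    by apply: eq_find => B; rewrite /= mem_widen_set.
  have ind0 : block_index (child d 0) ord_max = 0.
    by rewrite /block_index /= insert0 /= inE eqxx.
  case: (ord_lastP i) => [|{}i]; case: (ord_lastP j) => [|{}j].
  - by rewrite ltnn.
  - by rewrite [_ < _]ltnNge /= (ltnW (ltn_ord j)).
  - by rewrite ind ind0 andbF.
  - rewrite !ind ltnS => ij.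
    by apply/existsP; exists i; apply/existsP; exists j.
apply/existsP.
(* The bound on [p.+1] forces [d] to have a first block. *)
have:= woc_neq0 d; case ed: (blocks d : seq _) lep => [//|B s] _.
rewrite inE eq_sym => /norP[/set0Pn[i iB] _].
exists (widen_ord (leqnSn k) i); apply/existsP; exists ord_max.
rewrite /= ltn_ord /=; suff ->:
  block_index (child d p.+1) (widen_ord (leqnSn k) i) = 0 by [].
rewrite /block_index /= ed.
by case: p => [|p] /=; rewrite ?inE ?mem_widen_set iB ?orbT.
Qed.

Lemma nonstop_child k (d : woc k) (c : woc k.+1) : ~~ stop_le d ->
  (restrict c == d) && ~~ stop_le c = (c == child d 0).
Proof.
move=> nd; apply/andP/eqP=> [[rc]|->]; last by rewrite restrict_child stop_child.
have: c \in [set c | restrict c == d] by rewrite inE.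
rewrite restrict_fiber => /imsetP[p _ ->].
rewrite stop_child //; last exact: leq_ord.
by rewrite negbK => /eqP->.
Qed.

(** * Levels of the tree and their leaves *)

(** The parent [d] is [x_k < ... < x_1]. Starting from the empty chain on no variables makes the
    root a fiber like every later level. *)
Lemma tree_level_fiber k : exists d : woc k,
  [/\ size d = k, ~~ stop_le d &
      tree_level stop_le k.+1 = [set c | restrict c == d]].
Proof.
elim: k => [|k [d [sd nd ed]]].
  have P0 : is_osp (@nil {set 'I_0}).
    by rewrite is_ospE /=; apply/forallP => -[].
  exists (Woc (blocks := Bseq (osp_size P0)) P0); split=> //.
    by rewrite stop_leE; apply/existsP => -[[]].
  (* By [osp_size] a chain on no variables has no blocks, so every chain on one variable restricts
     to the empty chain. *)
  apply/setP=> c; rewrite !inE eqxx /=; apply/esym/eqP/woc_inj.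
  by apply/nilP; rewrite /nilp -leqn0; apply: osp_size; apply: blocksP.
(* The only node of the current level that has descendants. *)
exists (child d 0); split.
- by rewrite /= insert0 /= size_map sd.
- by rewrite stop_child.
by apply/setP=> c; rewrite /= in ed *; rewrite ed !inE nonstop_child.
Qed.

Lemma card_tree_level k : #|tree_level stop_le k.+1| = k.*2.+1.
Proof.
by have [d [sd _ ->]] := tree_level_fiber k; rewrite card_restrict_fiber sd.
Qed.

Lemma card_tree_level_nonstop k :
  #|[set c in tree_level stop_le k.+1 | ~~ stop_le c]| = 1.
Proof.
have [d [sd nd ->]] := tree_level_fiber k.
rewrite -(cards1 (child d 0)); congr #|pred_of_set _|; apply/setP=> c.
rewrite in_set1 inE.
by rewrite inE nonstop_child.
Qed.

(** All but one of the [2k + 1] nodes stop; the remaining one is a leaf only on the final level. *)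
Lemma card_leaves n k : #|leaves stop_le n k.+1| = k.*2 + (k.+1 == n).
Proof.
rewrite /leaves; move: (card_tree_level k) (card_tree_level_nonstop k).
move: (tree_level _ _) => L cL cN; case: eqVneq => _.
  by rewrite addn1 -cL; apply: eq_card => c; rewrite inE andbT.
rewrite addn0; apply: succn_inj; rewrite -cL -(cardsID [set c | stop_le c] L).
rewrite -addn1 -[X in _ + X = _]cN; congr (_ + _).
  by apply: eq_card => c; rewrite !inE.
by apply: eq_card => c; rewrite !inE andbC.
Qed.

Theorem theorem3 :
  (forall n : nat, 1 <= n -> num_chains stop_le n = n ^ 2 - n + 1) /\
  [seq num_chains stop_le n | n <- iota 1 8] = [:: 1; 3; 7; 13; 21; 31; 43; 57].
Proof.
have sum_double n : \sum_(0 <= k < n) k.*2 = n * n.-1.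
  elim: n => [|n IH]; first by rewrite big_geq.
  rewrite big_nat_recr //= IH -muln2 -mulnDr mulnC.
  by case: n {IH} => //= n; rewrite addn2.
have num n : 1 <= n -> num_chains stop_le n = n ^ 2 - n + 1.
  case: n => // n _; rewrite /num_chains big_add1 /=.
  rewrite (eq_big_nat _ _ (fun k _ => card_leaves n.+1 k)) big_split /= sum_double.
  (* In the sum of the indicators only the last term, at the final level, is nonzero. *)
  rewrite big_nat_recr //= eqxx big_nat big1 => [|k /andP[_ kn]]; last first.
    by rewrite eqSS ltn_eqF.
  by rewrite -mulnn -[X in _ - X]muln1 -mulnBr subn1.
(* The eight values are computed from the closed form, not by enumerating chains. *)
split=> //; rewrite (eq_in_map _ (fun n => n ^ 2 - n + 1) _).1 // => n.
by rewrite mem_iota => /andP[/num].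
Qed.
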